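(* For every positive integer $d$, there exists a finitely presented associative algebra $R$ (generated by a finite set $X$) whose growth function $\gamma_{X,R}$ satisfies $\gamma_{X,R}\sim e^{n^{d/(d+1)}}$; in particular $R$ has intermediate growth.
   Context: For an algebra $R$ over a field $k$ generated by a finite set $X$, let $X^n$ be the subspace spanned by all monomials in $X$ of length at most $n$, and define the growth function $\gamma_{X,R}(n)=\dim_k X^n$. For monotone functions $f,g:\mathbb{N}\to\mathbb{N}$ write $f\precsim g$ if there is a constant $C\in\mathbb{N}$ with $f(n)\le C\,g(Cn)$ for all $n$, and $f\sim g$ if $f\precsim g$ and $g\precsim f$; the class $[f]$ of $f$ under $\sim$ is its growth type (independent of the finite generating set). A growth type is intermediate if it is strictly smaller than $[2^n]$ (i.e. $\gamma\precsim 2^n$ but not $2^n\precsim\gamma$) and strictly greater than $[n^m]$ for every $m$. *)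

(* Defs.v *)
From Stdlib Require Import Reals.
From HB Require Import structures.
From mathcomp Require Import all_boot all_algebra.

Set Implicit Arguments.
Unset Strict Implicit.
Unset Printing Implicit Defensive.

Import GRing.Theory.

(** Free associative algebra k<x_0,...,x_{m-1}>: an element is a formal
    finite linear combination of words (monomials) in the m generators.
    Two formal sums denote the same element iff they have the same
    coefficient function [nccoef]. *)
Definition ncpoly (k : Type) (m : nat) := seq (k * seq 'I_m).

Definition nccoef (k : fieldType) (m : nat) (p : ncpoly k m) (w : seq 'I_m) : k :=
  (\sum_(t <- p | t.2 == w) t.1)%R.

Definition ncmul (k : fieldType) (m : nat) (p q : ncpoly k m) : ncpoly k m :=
  [seq ((t.1 * s.1)%R, t.2 ++ s.2) | t <- p, s <- q].

Definition ncscale (k : fieldType) (m : nat) (a : k) (p : ncpoly k m) : ncpoly k m :=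
  [seq ((a * t.1)%R, t.2) | t <- p].

Definition in_ideal (k : fieldType) (m : nat) (rels : seq (ncpoly k m))
    (p : ncpoly k m) : Prop :=
  exists ts : seq (ncpoly k m * ncpoly k m * ncpoly k m),
    all (fun t => t.1.2 \in rels) ts /\
    forall w, nccoef p w
              = nccoef (flatten [seq ncmul (ncmul t.1.1 t.1.2) t.2 | t <- ts]) w.

Definition in_Xn (k : fieldType) (m : nat) (n : nat) (p : ncpoly k m) : bool :=
  all (fun t => size t.2 <= n) p.

(** in R = k<X>/(rels), the subspace X^n contains c linearly independent
    elements (images of ps j) *)
Definition indep_in_Xn (k : fieldType) (m : nat) (rels : seq (ncpoly k m))
    (n c : nat) : Prop :=
  exists ps : 'I_c -> ncpoly k m,
    (forall j, in_Xn n (ps j)) /\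
    forall lam : 'I_c -> k,
      in_ideal rels (flatten [seq ncscale (lam j) (ps j) | j <- enum 'I_c]) ->
      forall j, lam j = 0%R.

(** gamma_{X,R}(n) = dim_k X^n = c, for R = k<x_0..x_{m-1}>/(rels) *)
Definition growth_value (k : fieldType) (m : nat) (rels : seq (ncpoly k m))
    (n c : nat) : Prop :=
  indep_in_Xn rels n c /\ forall c', indep_in_Xn rels n c' -> c' <= c.

Definition precsim (f g : nat -> nat) : Prop :=
  exists C : nat, forall n, f n <= C * g (C * n).

Definition precsimR (f g : nat -> R) : Prop :=
  exists C : nat, forall n, Rle (f n) (Rmult (INR C) (g (C * n)%N)).

Definition simR (f g : nat -> R) : Prop := precsimR f g /\ precsimR g f.

Definition intermediate (g : nat -> nat) : Prop :=
  (precsim g (fun n => 2 ^ n) /\ ~ precsim (fun n => 2 ^ n) g) /\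
  forall e : nat, precsim (fun n => n ^ e) g /\ ~ precsim g (fun n => n ^ e).

(* Main.v *)
Require Import Defs.
From Stdlib Require Import Reals.
From HB Require Import structures.
From mathcomp Require Import all_boot all_order all_algebra.
From mathcomp Require Import generic_quotient boolp Rstruct mpoly.
From mathcomp Require Import ring lra zify.

Set Implicit Arguments.
Unset Strict Implicit.
Unset Printing Implicit Defensive.

Import Order.TTheory GRing.Theory Num.Theory.
Local Open Scope ring_scope.

(* Generators [e, t_r, s_r] ([r < d]).  Write [e_w] for the iterated commutator
   of [e] with the [t_r], [r] in [w]; as the [t]'s commute, it only depends on
   the exponent vector of [w].  Besides the commutation of the [t]'s and [s]'s,
   the relations are [s_r e = e s_r + [t_r, e] t_r] and [[e_v, e_w] = 0] for
   squarefree [v] and [w].  Let [M = k[x_1, ..., x_d]], with basis the [e_w].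
   On [M ⊗ M], [t_r] acts as [x_r + y_r] and, thanks to the divided-power shape
   of its relation, [s_r] acts as [x_r y_r] over any field.  Since [k[x, y]] is
   finite over these elementary symmetric functions, finitely many commutators
   [[e_v, e_w]] generate all of them, so the algebra is the smash product of
   [Sym M] with [k[t, s]].  Its monomial basis up to degree [n] is, up to a
   linear change of [n], a set of multisets of vectors in N^d of total weight
   at most [n], whence the growth [exp (n ^ (d / (d + 1)))].

   Upper bound: commuting letters past each other shows that such normal
   monomials span; they are counted by the generating function, factored through
   [1 + u + ... + u ^ (2 ^ K - 1) = prod_i (1 + u ^ (2 ^ i))] with
   [1 + v <= exp v], at [z = exp (- n ^ (- 1 / (d + 1)))].
   Lower bound: the algebra acts on polynomials in variables [X_a], [a] in the
   box [[0, L)^d], where [e] multiplies by [X_0] and [t_r], [s_r] take the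
   coefficients of [z] and [z^2] in the substitution
   [X_a -> X_a + z X_(a + eps_r)]; the products of the [e_a] over the subsets of
   the box act on [1] as distinct monomials. *)

(** * Presented algebras *)

Section Linearization.
Variables (k : fieldType) (m : nat).
Implicit Types p q r : ncpoly k m.

(** Coefficient extraction ([nccoefE]) and the action on a module ([pact]) are both linear
    extensions from words, so one calculus serves for both. *)
Definition lin (V : lmodType k) (F : seq 'I_m -> V) p : V :=
  \sum_(t <- p) t.1 *: F t.2.

Lemma lin_cat (V : lmodType k) (F : seq 'I_m -> V) p q :
  lin F (p ++ q) = lin F p + lin F q.
Proof. exact: big_cat. Qed.

Lemma lin_scale (V : lmodType k) (F : seq 'I_m -> V) a p :
  lin F (ncscale a p) = a *: lin F p.
Proof.
by rewrite /lin big_map scaler_sumr; apply: eq_bigr => t _; rewrite scalerA.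
Qed.

Lemma lin_mul (V : lmodType k) (F : seq 'I_m -> V) p q :
  lin F (ncmul p q) = lin (fun u => lin (fun w => F (u ++ w)) q) p.
Proof.
rewrite /lin /ncmul big_allpairs_dep; apply: eq_bigr => t _.
by rewrite scaler_sumr; apply: eq_bigr => s _; rewrite scalerA.
Qed.

Lemma eq_lin (V : lmodType k) (F G : seq 'I_m -> V) p :
  F =1 G -> lin F p = lin G p.
Proof. by move=> FG; apply: eq_bigr => t _; rewrite FG. Qed.

Lemma lin_add (V : lmodType k) (F G : seq 'I_m -> V) p :
  lin (fun u => F u + G u) p = lin F p + lin G p.
Proof. by rewrite /lin -big_split; apply: eq_bigr => t _; rewrite scalerDr. Qed.

Lemma lin_sub (V : lmodType k) (F G : seq 'I_m -> V) p :
  lin (fun u => F u - G u) p = lin F p - lin G p.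
Proof. by rewrite /lin -sumrB; apply: eq_bigr => t _; rewrite scalerBr. Qed.

Lemma lin_sum (V : lmodType k) (I : Type) (r : seq I) (F : I -> seq 'I_m -> V) p :
  lin (fun u => \sum_(i <- r) F i u) p = \sum_(i <- r) lin (F i) p.
Proof.
rewrite /lin; under eq_bigr do rewrite scaler_sumr.
by rewrite exchange_big.
Qed.

Lemma lin_flatten (V : lmodType k) (F : seq 'I_m -> V) (ps : seq (ncpoly k m)) :
  lin F (flatten ps) = \sum_(p <- ps) lin F p.
Proof.
elim: ps => [|p ps IH] /=; first by rewrite /lin !big_nil.
by rewrite lin_cat IH big_cons.
Qed.

Lemma nccoefE p w : nccoef p w = lin (fun u => (u == w)%:R : k^o) p.
Proof.
rewrite /nccoef /lin big_mkcond; apply: eq_bigr => t _ /=.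
by case: eqP => _; rewrite ?scaler0 // -[RHS]/(t.1 * 1) mulr1.
Qed.

Lemma lin_nccoef (V : lmodType k) (F : seq 'I_m -> V) p (s : seq (seq 'I_m)) :
  uniq s -> {subset [seq t.2 | t <- p] <= s} ->
  lin F p = \sum_(w <- s) nccoef p w *: F w.
Proof.
move=> us sub; under [RHS]eq_bigr do rewrite /nccoef scaler_suml big_mkcond.
rewrite exchange_big /= [LHS]big_seq [RHS]big_seq; apply: eq_bigr => t tp.
have ts : t.2 \in s by apply: sub; apply/mapP; exists t.
rewrite (bigD1_seq t.2) //= eqxx big1 ?addr0 // => w.
by rewrite eq_sym => /negbTE ->.
Qed.

(** A formal sum may repeat a word; regrouping both sums over one duplicate-free list of words
    leaves only the coefficients. *)
Lemma lin_eqcoef (V : lmodType k) (F : seq 'I_m -> V) p q :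
  nccoef p =1 nccoef q -> lin F p = lin F q.
Proof.
move=> pq; pose s := undup ([seq t.2 | t <- p] ++ [seq t.2 | t <- q]).
rewrite (@lin_nccoef _ F p s) ?(@lin_nccoef _ F q s) ?undup_uniq //.
- by apply: eq_bigr => w _; rewrite pq.
- by move=> w; rewrite mem_undup mem_cat orbC => ->.
- by move=> w; rewrite mem_undup mem_cat => ->.
Qed.

Lemma ncmulA p q r : nccoef (ncmul (ncmul p q) r) =1 nccoef (ncmul p (ncmul q r)).
Proof.
move=> w; rewrite !nccoefE !lin_mul; apply: (@eq_lin k^o) => u.
by rewrite lin_mul; do 2!apply: eq_lin => ?; rewrite catA.
Qed.

Lemma ncscaleE a p : ncscale a p = ncmul [:: (a, [::])] p.
Proof. by rewrite /ncmul /= cats0. Qed.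

End Linearization.

(** * The two-sided ideal of the relations *)

Section Ideal.
Variables (k : fieldType) (m : nat) (rels : seq (ncpoly k m)).
Implicit Types p q r : ncpoly k m.
Local Notation J := (in_ideal rels).

Lemma in_ideal_eq p q : nccoef p =1 nccoef q -> J p -> J q.
Proof. by move=> pq [ts [tsr e]]; exists ts; split=> // w; rewrite -pq e. Qed.

Lemma in_ideal0 p : (forall w, nccoef p w = 0) -> J p.
Proof. by move=> p0; exists [::]; split=> // w; rewrite p0 /nccoef big_nil. Qed.

Lemma in_ideal_cat p q : J p -> J q -> J (p ++ q).
Proof.
move=> [ts [tsr e]] [ts' [tsr' e']]; exists (ts ++ ts'); split.
  by rewrite all_cat tsr.
move=> w; rewrite map_cat flatten_cat.
by move: (e w) (e' w); rewrite !nccoefE !lin_cat => -> ->.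
Qed.

Lemma in_ideal_mull q p : J p -> J (ncmul q p).
Proof.
move=> [ts [tsr e]]; exists [seq ((ncmul q t.1.1, t.1.2), t.2) | t <- ts].
split; first by rewrite all_map.
move=> w; rewrite !nccoefE lin_mul -map_comp lin_flatten big_map /=.
transitivity (lin (fun u => \sum_(t <- ts) lin (fun v => (u ++ v == w)%:R : k^o)
    (ncmul (ncmul t.1.1 t.1.2) t.2)) q).
  by apply: (@eq_lin _ _ k^o) => u; rewrite (lin_eqcoef _ e) lin_flatten big_map.
rewrite lin_sum; apply: eq_bigr => t _; rewrite !lin_mul.
apply: (@eq_lin _ _ k^o) => u; rewrite !lin_mul.
by do 3!apply: eq_lin => ?; rewrite !catA.
Qed.

Lemma in_ideal_mulr q p : J p -> J (ncmul p q).
Proof.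
move=> [ts [tsr e]]; exists [seq ((t.1.1, t.1.2), ncmul t.2 q) | t <- ts].
split; first by rewrite all_map.
move=> w; rewrite !nccoefE lin_mul (lin_eqcoef _ e) -map_comp.
rewrite !lin_flatten !big_map; apply: eq_bigr => t _ /=.
rewrite !lin_mul; apply: (@eq_lin _ _ k^o) => u.
apply: eq_lin => v.
by rewrite !lin_mul; do 2!apply: eq_lin => ?; rewrite !catA.
Qed.

Lemma in_ideal_rel p : p \in rels -> J p.
Proof.
move=> pr; exists [:: (([:: (1, [::])], p), [:: (1, [::])])]; split => /=.
  by rewrite pr.
move=> w; rewrite cats0 !nccoefE !lin_mul {2}/lin big_seq1 scale1r.
apply: (@eq_lin _ _ k^o) => u.
by rewrite /lin big_seq1 scale1r cats0.
Qed.

Lemma in_ideal_scale a p : J p -> J (ncscale a p).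
Proof. by rewrite ncscaleE; apply: in_ideal_mull. Qed.

End Ideal.

(** * The quotient ring *)

Section Quotient.
Variables (k : fieldType) (m : nat) (rels : seq (ncpoly k m)).
Implicit Types p q r : ncpoly k m.
Local Notation J := (in_ideal rels).

(** Ideal membership comes with no decision procedure; classical reflection makes it a boolean
    relation, as the quotient construction requires. *)
Definition ideal_eq : rel (ncpoly k m) := fun p q => `[< J (p ++ ncscale (-1) q) >].

Fact ideal_eq_refl : reflexive ideal_eq.
Proof.
move=> p; apply/asboolP/in_ideal0 => w.
by rewrite nccoefE lin_cat lin_scale scaleN1r subrr.
Qed.

Fact ideal_eq_sym : ssrbool.symmetric ideal_eq.
Proof.
suff H p q : ideal_eq p q -> ideal_eq q p by move=> p q; apply/idP/idP; apply: H.
move=> /asboolP/(in_ideal_scale (-1)) H; apply/asboolP; apply: in_ideal_eq H => w.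
by rewrite !nccoefE !(lin_cat, lin_scale) !scaleN1r opprB.
Qed.

Fact ideal_eq_trans : transitive ideal_eq.
Proof.
move=> q p r /asboolP pq /asboolP qr; apply/asboolP.
apply: in_ideal_eq (in_ideal_cat pq qr) => w.
by rewrite !nccoefE !(lin_cat, lin_scale) !scaleN1r addrA subrK.
Qed.

Canonical ideal_equiv := EquivRel ideal_eq ideal_eq_refl ideal_eq_sym ideal_eq_trans.

Definition presAlg : Type := {eq_quot ideal_eq}%qT.
HB.instance Definition _ := Choice.on presAlg.

Definition cl p : presAlg := \pi_({eq_quot ideal_eq})%qT p.

Lemma clP p q : cl p = cl q <-> J (p ++ ncscale (-1) q).
Proof.
split=> [/eqmodP/asboolP // | H].
by apply/eqmodP/asboolP.
Qed.

Lemma cl_ind (P : presAlg -> Prop) : (forall p, P (cl p)) -> forall x, P x.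
Proof. by move=> H x; rewrite -[x]reprK; apply: H. Qed.

Lemma eq_cl p q : nccoef p =1 nccoef q -> cl p = cl q.
Proof.
move=> pq; apply/clP/in_ideal0 => w.
by rewrite nccoefE lin_cat lin_scale (lin_eqcoef _ pq) scaleN1r subrr.
Qed.

Lemma cl_repr (x : presAlg) : cl (repr x) = x.
Proof. exact: reprK. Qed.

Definition qadd (x y : presAlg) : presAlg := cl (repr x ++ repr y).
Definition qopp (x : presAlg) : presAlg := cl (ncscale (-1) (repr x)).
Definition qmul (x y : presAlg) : presAlg := cl (ncmul (repr x) (repr y)).

Lemma qaddE p q : qadd (cl p) (cl q) = cl (p ++ q).
Proof.
have /clP Hp := cl_repr (cl p); have /clP Hq := cl_repr (cl q).
apply/clP; apply: in_ideal_eq (in_ideal_cat Hp Hq) => w.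
rewrite !nccoefE !(lin_cat, lin_scale) !scaleN1r; ring.
Qed.

Lemma qoppE p : qopp (cl p) = cl (ncscale (-1) p).
Proof.
have /clP Hp := cl_repr (cl p); apply/clP.
apply: in_ideal_eq (in_ideal_scale (-1) Hp) => w.
rewrite !nccoefE !(lin_cat, lin_scale) !scaleN1r; ring.
Qed.

(** [p' q' - p q = (p' - p) q' + p (q' - q)], with both summands in the ideal. *)
Lemma qmulE p q : qmul (cl p) (cl q) = cl (ncmul p q).
Proof.
have /clP Hp := cl_repr (cl p); have /clP Hq := cl_repr (cl q).
apply/clP; apply: in_ideal_eq (in_ideal_cat (in_ideal_mulr (repr (cl q)) Hp)
  (in_ideal_mull p Hq)) => w.
rewrite !nccoefE !(lin_cat, lin_mul, lin_scale) /=.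
have -> : lin (fun u => lin (fun v => (u ++ v == w)%:R : k^o)
    (repr (cl q) ++ ncscale (-1) q)) p =
  lin (fun u => lin (fun v => (u ++ v == w)%:R : k^o) (repr (cl q))) p
  - lin (fun u => lin (fun v => (u ++ v == w)%:R : k^o) q) p.
  rewrite -lin_sub; apply: (@eq_lin _ _ k^o) => u.
  by rewrite lin_cat lin_scale scaleN1r.
rewrite !scaleN1r; ring.
Qed.

Fact qaddA : associative qadd.
Proof.
by elim/cl_ind=> p; elim/cl_ind=> q; elim/cl_ind=> r; rewrite !qaddE catA.
Qed.
Fact qaddC : commutative qadd.
Proof.
elim/cl_ind=> p; elim/cl_ind=> q; rewrite !qaddE; apply: eq_cl => w.
by rewrite !nccoefE !lin_cat addrC.
Qed.
Fact qadd0 : left_id (cl [::]) qadd.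
Proof. by elim/cl_ind=> p; rewrite qaddE. Qed.
Fact qaddN : left_inverse (cl [::]) qopp qadd.
Proof.
elim/cl_ind=> p; rewrite qoppE qaddE; apply: eq_cl => w.
by rewrite !nccoefE lin_cat lin_scale scaleN1r addNr /lin big_nil.
Qed.
HB.instance Definition _ := GRing.isZmodule.Build presAlg qaddA qaddC qadd0 qaddN.

Fact qmulA : associative qmul.
Proof.
elim/cl_ind=> p; elim/cl_ind=> q; elim/cl_ind=> r.
by rewrite !qmulE; apply/eq_cl/fsym/ncmulA.
Qed.
Fact qmul1 : left_id (cl [:: (1, [::])]) qmul.
Proof.
elim/cl_ind=> p; rewrite qmulE -ncscaleE; apply: eq_cl => w.
by rewrite !nccoefE lin_scale scale1r.
Qed.
Fact qmulr1 : right_id (cl [:: (1, [::])]) qmul.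
Proof.
elim/cl_ind=> p; rewrite qmulE; apply: eq_cl => w.
rewrite !nccoefE lin_mul; apply: (@eq_lin _ _ k^o) => u.
by rewrite /lin big_seq1 scale1r cats0.
Qed.
Fact qmulDl : left_distributive qmul qadd.
Proof.
elim/cl_ind=> p; elim/cl_ind=> q; elim/cl_ind=> r.
by rewrite !(qaddE, qmulE); apply/eq_cl => w; rewrite !(nccoefE, lin_mul, lin_cat).
Qed.
Fact qmulDr : right_distributive qmul qadd.
Proof.
elim/cl_ind=> p; elim/cl_ind=> q; elim/cl_ind=> r.
rewrite !(qaddE, qmulE); apply/eq_cl => w; rewrite !(nccoefE, lin_cat) !lin_mul.
rewrite -lin_add; apply: (@eq_lin _ _ k^o) => u; exact: lin_cat.
Qed.
(** Arbitrary relations may force [1 = 0], hence a ring structure that allows it. *)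
HB.instance Definition _ :=
  GRing.Zmodule_isPzRing.Build presAlg qmulA qmul1 qmulr1 qmulDl qmulDr.

Lemma cl_cat p q : cl (p ++ q) = cl p + cl q.
Proof. exact/esym/qaddE. Qed.
Lemma cl_mul p q : cl (ncmul p q) = cl p * cl q.
Proof. exact/esym/qmulE. Qed.
Lemma cl_opp p : cl (ncscale (-1) p) = - cl p.
Proof. exact/esym/qoppE. Qed.

Lemma cl_eq0 p : cl p = 0 <-> J p.
Proof.
have -> : 0 = cl [::] by [].
split=> [/clP|H]; first by rewrite cats0.
by apply/clP; rewrite cats0.
Qed.

(** Scalars enter as central elements of the ring rather than through a module structure. *)
Definition qcst (a : k) : presAlg := cl [:: (a, [::])].

Lemma cl_scale a p : cl (ncscale a p) = qcst a * cl p.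
Proof. by rewrite ncscaleE cl_mul. Qed.

Lemma qcstC a x : qcst a * x = x * qcst a.
Proof.
elim/cl_ind: x => p; rewrite -cl_scale -cl_mul; apply: eq_cl => w.
rewrite !nccoefE lin_scale lin_mul {2}/lin /lin scaler_sumr.
by apply: eq_bigr => t _; rewrite big_seq1 !scalerA cats0 mulrC.
Qed.

Lemma qcst1 : qcst 1 = 1. Proof. by []. Qed.

Lemma qcstD a b : qcst (a + b) = qcst a + qcst b.
Proof.
rewrite -cl_cat; apply: eq_cl => w.
by rewrite !nccoefE lin_cat /lin !big_seq1 scalerDl.
Qed.

Lemma qcstM a b : qcst (a * b) = qcst a * qcst b.
Proof. by rewrite -cl_mul. Qed.

Definition qgen (i : 'I_m) : presAlg := cl [:: (1, [:: i])].

Lemma cl_word w : cl [:: (1, w)] = \prod_(i <- w) qgen i.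
Proof.
elim: w => [|i w IH]; first by rewrite big_nil.
by rewrite big_cons -IH -cl_mul; apply: eq_cl => u; rewrite /ncmul /= mulr1.
Qed.

Lemma clE p : cl p = \sum_(t <- p) qcst t.1 * \prod_(i <- t.2) qgen i.
Proof.
elim: p => [|[a w] p IH]; first by rewrite big_nil.
by rewrite big_cons -IH -cl_word -cl_scale -cl_cat /= mulr1.
Qed.

Lemma cl_flatten (ps : seq (ncpoly k m)) : cl (flatten ps) = \sum_(p <- ps) cl p.
Proof.
elim: ps => [|p ps IH]; first by rewrite big_nil.
by rewrite big_cons -IH -cl_cat.
Qed.

End Quotient.

(** * Commutation and normal forms *)

(** Bracketing with [t] is a derivation, here applied to [x y = y x]. *)
Lemma comm_derive (A : pzRingType) (t x y x' y' : A) :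
    t * x = x * t + x' -> t * y = y * t + y' -> x * y = y * x ->
  x' * y + x * y' = y' * x + y * x'.
Proof.
move=> tx ty xy; have: t * (x * y) = t * (y * x) by rewrite xy.
rewrite !mulrA tx ty !mulrDl -![_ * t * _]mulrA tx ty !mulrDr !mulrA xy.
by rewrite -!addrA => /addrI; rewrite addrC => ->; rewrite addrC.
Qed.

(* Comparing [s x y] with [s y x], the coefficient of [t] vanishes by
   [comm_derive] and what remains is the commutator of [x'] and [y']. *)
Lemma comm_derive2 (A : pzRingType) (t s x y x' y' : A) :
    t * x = x * t + x' -> t * y = y * t + y' ->
    s * x = x * s + x' * t -> s * y = y * s + y' * t -> x * y = y * x ->
  x' * y' = y' * x'.
Proof.
move=> tx ty sx sy xy; have D := comm_derive tx ty xy.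
have: s * (x * y) = s * (y * x) by rewrite xy.
rewrite !mulrA sx sy !mulrDl -![_ * s * _]mulrA -![_ * t * _]mulrA.
rewrite sx sy tx ty !mulrDr !mulrA xy -!addrA => /addrI.
rewrite !addrA -!mulrDl [x * y' + _]addrC D [y * x' + _]addrC.
exact: addrI.
Qed.

(** * Commutation of all the e_w, and straightening of words *)

Section Relations.
Variables (A : pzRingType) (d : nat) (e : A) (g : 'I_d * bool -> A).
Local Notation t r := (g (r, false)).
Local Notation s r := (g (r, true)).

Fixpoint iad (w : seq 'I_d) : A :=
  if w is r :: w' then t r * iad w' - iad w' * t r else e.

Hypothesis gC : forall x y, g x * g y = g y * g x.
Hypothesis se : forall r, s r * e = e * s r + iad [:: r] * t r.
Hypothesis base : forall V W : {set 'I_d},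
  iad (enum V) * iad (enum W) = iad (enum W) * iad (enum V).

Lemma t_iad r w : t r * iad w = iad w * t r + iad (r :: w).
Proof. by rewrite /= addrC subrK. Qed.

(** Jacobi identity, the bracket of [t r] and [t q] being zero. *)
Lemma iad_swap r q w : iad (r :: q :: w) = iad (q :: r :: w).
Proof.
rewrite /= !(mulrBl, mulrBr) !mulrA [t r * t q]gC.
rewrite -![iad w * _ * _]mulrA [t r * t q]gC !opprB.
by rewrite -!addrA; congr (_ + _); rewrite addrCA [in RHS]addrCA [- _ - _]addrC !addrA
  [iad w * _ - _]addrC.
Qed.

Lemma iad_perm v w : perm_eq v w -> iad v = iad w.
Proof.
have mid r w1 w2 : iad (w1 ++ r :: w2) = iad (r :: w1 ++ w2).
  by elim: w1 => // q w1 IH; rewrite iad_swap /= IH.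
elim: v w => [|r v IH] w; first by rewrite perm_sym => /perm_nilP ->.
move=> pvw; have rw : r \in w by rewrite -(perm_mem pvw) mem_head.
case/splitPr: rw pvw => w1 w2; rewrite perm_sym perm_catC /= perm_cons perm_catC.
by rewrite perm_sym mid => /IH /= ->.
Qed.

(** Bracketing the identity for [w] with [t q] gives the one for [q :: w], since [t q] commutes with
    [s r] and [t r]. *)
Lemma s_iad r w : s r * iad w = iad w * s r + iad (r :: w) * t r.
Proof.
elim: w => [|q w IH]; first exact: se.
rewrite iad_swap.
have -> : iad (q :: w) = t q * iad w - iad w * t q by [].
have -> : iad (q :: r :: w) = t q * iad (r :: w) - iad (r :: w) * t q by [].
move: (iad (r :: w)) IH => y IH.
rewrite mulrBr !mulrA [s r * t q]gC IH -[t q * s r * _]mulrA IH.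
rewrite !(mulrBl, mulrDr, mulrDl) !mulrA -[_ * s r * t q]mulrA [s r * t q]gC.
by rewrite -[y * t r * t q]mulrA [t r * t q]gC !mulrA opprD addrACA.
Qed.

Lemma iad_comm2 r v w : iad v * iad w = iad w * iad v ->
  iad (r :: v) * iad (r :: w) = iad (r :: w) * iad (r :: v).
Proof. exact/comm_derive2/s_iad/s_iad/t_iad/t_iad. Qed.

(** This is why finitely many relations suffice: a repeated letter reduces the claim to shorter
    pairs, until both words are squarefree. *)
Lemma iad_comm v w : iad v * iad w = iad w * iad v.
Proof.
have [n] := ubnP (size v + size w); elim: n v w => // n IH.
(* By symmetry the first word may be taken to repeat a letter; squarefree pairs are covered by
   [base] after reordering. *)
suff H v w : (size v + size w < n.+1)%N -> ~~ uniq v ->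
    iad v * iad w = iad w * iad v.
  move=> v w vw; have [uv|/(H _ _ vw)//] := boolP (uniq v).
  have [uw|/H-> //] := boolP (uniq w); last by rewrite addnC.
  have pe (u : seq 'I_d) : uniq u -> perm_eq u (enum [set x in u]).
    by move=> uu; apply: uniq_perm; rewrite ?enum_uniq // => x; rewrite mem_enum inE.
  by rewrite (iad_perm (pe _ uv)) (iad_perm (pe _ uw)) base.
have dup (T : eqType) (u : seq T) : ~~ uniq u -> exists r u', perm_eq u [:: r, r & u'].
  elim: u => // r u IHu /=; rewrite negb_and negbK => /orP[ru|/IHu[q [u' pu]]].
    by exists r, (rem r u); rewrite perm_cons perm_to_rem.
  exists q, (r :: u'); rewrite -(perm_cons r) in pu; apply: (perm_trans pu).
  exact/permPl/(perm_catCA [:: r] [:: q; q] u').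
move=> vw /dup[r [v' pv]]; rewrite (iad_perm pv); move: vw.
rewrite (perm_size pv) /= !addSn !ltnS => vw.
(* Bracketing [[e_(r v'), e_w] = 0] with [t r] gives [[e_(r r v'), e_w] + [e_(r v'), e_(r w)] = 0],
   whose second term vanishes by [iad_comm2]. *)
have D := comm_derive (t_iad r (r :: v')) (t_iad r w) (IH (r :: v') w vw).
have C := iad_comm2 r (IH v' w (ltnW vw)).
by move: D; rewrite C addrC => /addrI.
Qed.

Variables (k : fieldType) (cst : k -> A).
Hypothesis cstC : forall a x, cst a * x = x * cst a.
Hypothesis cst1 : cst 1 = 1.
Hypothesis cstM : forall a b, cst (a * b) = cst a * cst b.

Definition nmon (ws : seq (seq 'I_d)) (u : seq ('I_d * bool)) : A :=
  (\prod_(w <- ws) iad w) * \prod_(x <- u) g x.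

(** With weight 1 for [e] and [t r] and weight 2 for [s r], all relations are homogeneous, so
    straightening never raises the weight. A word of length [n] has weight at most [2 n]. *)
Definition nwt (ws : seq (seq 'I_d)) (u : seq ('I_d * bool)) : nat :=
  (\sum_(w <- ws) (size w).+1 + \sum_(x <- u) (x.2 : nat).+1)%N.

Inductive nspan (W : nat) : A -> Prop :=
| nspan0 : nspan W 0
| nspanD a ws u x : (nwt ws u <= W)%N -> nspan W x ->
    nspan W (cst a * nmon ws u + x).

Lemma nspan_mon W ws u : (nwt ws u <= W)%N -> nspan W (nmon ws u).
Proof.
by move=> h; rewrite -[nmon _ _]addr0 -[nmon _ _]mul1r -cst1; apply: nspanD h (nspan0 _).
Qed.

Lemma nspan_add W x y : nspan W x -> nspan W y -> nspan W (x + y).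
Proof.
move=> + Hy; elim=> [|a ws u z h _ IH]; first by rewrite add0r.
by rewrite -addrA; apply: nspanD.
Qed.

Lemma nspan_cst W a x : nspan W x -> nspan W (cst a * x).
Proof.
elim=> [|b ws u z h _ IH]; first by rewrite mulr0; apply: nspan0.
by rewrite mulrDr mulrA -cstM; apply: nspanD.
Qed.

Lemma nspan_le W W' x : (W <= W')%N -> nspan W x -> nspan W' x.
Proof.
move=> h; elim=> [|b ws u z h' _ IH]; first exact: nspan0.
by apply: nspanD IH; apply: leq_trans h.
Qed.

Lemma nspan_mull W D y : (forall ws u, nspan (nwt ws u + D) (y * nmon ws u)) ->
  forall x, nspan W x -> nspan (W + D) (y * x).
Proof.
move=> H x; elim=> [|a ws u z h _ IH]; first by rewrite mulr0; apply: nspan0.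
rewrite mulrDr mulrA -cstC -mulrA; apply: nspan_add IH; apply: nspan_cst.
by apply: nspan_le (H _ _); rewrite leq_add2r.
Qed.

Lemma nmon_cons w ws u : nmon (w :: ws) u = iad w * nmon ws u.
Proof. by rewrite /nmon big_cons mulrA. Qed.

Lemma nwt_cons w ws u : nwt (w :: ws) u = (nwt ws u + (size w).+1)%N.
Proof. by rewrite /nwt big_cons -addnA addnC. Qed.

Lemma nspan_iad W w x : nspan W x -> nspan (W + (size w).+1) (iad w * x).
Proof.
apply: nspan_mull => ws u; rewrite -nmon_cons; apply: nspan_mon.
by rewrite nwt_cons.
Qed.

Lemma nspan_g_nil (x : 'I_d * bool) u :
  nspan (nwt [::] u + (x.2 : nat).+1) (g x * nmon [::] u).
Proof.
have -> : g x * nmon [::] u = nmon [::] (x :: u).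
  by rewrite /nmon !big_nil !mul1r big_cons.
by apply: nspan_mon; rewrite /nwt !big_nil big_cons !add0n addnC.
Qed.

Lemma nspan_t W r x : nspan W x -> nspan (W + 1) (t r * x).
Proof.
apply: nspan_mull => ws u; elim: ws => [|w ws IH]; first exact: (nspan_g_nil (r, false)).
rewrite nmon_cons mulrA t_iad mulrDl -mulrA.
apply: nspan_add; first by rewrite nwt_cons addnAC; apply: nspan_iad.
by rewrite -nmon_cons; apply: nspan_mon; rewrite !nwt_cons /= addn1 addnS.
Qed.

Lemma nspan_s W r x : nspan W x -> nspan (W + 2) (s r * x).
Proof.
apply: nspan_mull => ws u; elim: ws => [|w ws IH]; first exact: (nspan_g_nil (r, true)).
rewrite nmon_cons mulrA s_iad mulrDl -!mulrA.
apply: nspan_add; first by rewrite nwt_cons addnAC; apply: nspan_iad.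
apply: (@nspan_le (nwt ws u + 1 + (size (r :: w)).+1)).
  by rewrite nwt_cons /=; lia.
by apply: nspan_iad; apply: nspan_t; apply: nspan_mon.
Qed.

Lemma nspan_word (w : seq (option ('I_d * bool))) :
  nspan (size w * 2) (\prod_(i <- w) if i is Some x then g x else e).
Proof.
elim: w => [|i w IH].
  rewrite big_nil; have -> : 1 = nmon [::] [::] by rewrite /nmon !big_nil mulr1.
  by apply: nspan_mon; rewrite /nwt !big_nil.
rewrite big_cons mulSn addnC; case: i => [[r []]|].
- exact: nspan_s.
- by apply: nspan_le (nspan_t r IH); rewrite leq_add2l.
- by apply: nspan_le (nspan_iad [::] IH); rewrite leq_add2l.
Qed.

End Relations.

Lemma prod_comm_count (A : pzRingType) (I : finType) (h : I -> A) :
  (forall i j, h i * h j = h j * h i) ->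
  forall s : seq I, \prod_(i <- s) h i = \prod_i h i ^+ count_mem i s.
Proof.
move=> hC s; elim: s => [|x s IH]; first by rewrite big_nil big1.
rewrite big_cons {}IH /=.
(* Arbitrary exponents [c] allow an induction along the enumeration of [I], in which [h x] moves
   right to its own power. *)
suff H (c : I -> nat) : h x * \prod_i h i ^+ c i = \prod_i h i ^+ ((x == i) + c i).
  exact: (H (fun i => count_mem i s)).
have : uniq (index_enum I) by apply: index_enum_uniq.
have : x \in index_enum I by apply: mem_index_enum.
elim: (index_enum I) => // i r IH; rewrite inE /= => xir /andP[ir ur].
rewrite !big_cons; have [xi|xi] := eqVneq x i.
  rewrite -{i}xi in xir ir *; rewrite mulrA -exprS add1n; congr (_ * _).
  rewrite !big_seq; apply: eq_bigr => j jr.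
  by case: eqVneq => // jx; rewrite jx jr in ir.
rewrite (negbTE xi) /= in xir *; rewrite -IH // !mulrA; congr (_ * _).
by apply: commrX; apply: hC.
Qed.

Lemma sum_count (I : finType) (F : I -> nat) (s : seq I) :
  (\sum_(i <- s) F i = \sum_i count_mem i s * F i)%N.
Proof.
elim: s => [|x s IH]; first by rewrite big_nil big1.
rewrite big_cons IH /=; under [RHS]eq_bigr do rewrite mulnDl.
rewrite big_split /=; congr (_ + _)%N.
rewrite (bigD1 x) //= eqxx mul1n big1 ?addn0 // => i.
by rewrite eq_sym => /negbTE ->.
Qed.

(** * Independent families are no larger than a finite spanning family *)

Section FiniteSpan.
Variables (A : pzRingType) (k : fieldType) (cst : k -> A).
Hypothesis cstD : forall a b, cst (a + b) = cst a + cst b.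
Hypothesis cstM : forall a b, cst (a * b) = cst a * cst b.
Variables (I : finType) (b : I -> A).

Lemma cst_0 : cst 0 = 0.
Proof. by apply: (addrI (cst 0)); rewrite -cstD !addr0. Qed.

Lemma cst_sum (T : Type) (r : seq T) (F : T -> k) :
  cst (\sum_(i <- r) F i) = \sum_(i <- r) cst (F i).
Proof. exact: (big_morph _ cstD cst_0). Qed.

(** If [c] exceeded [#|I|], the coefficient matrix would have a nonzero left kernel, and a row of it
    is a linear dependency. *)
Lemma indep_leq_card (c : nat) (p : 'I_c -> A) (a : 'I_c -> I -> k) :
    (forall j, p j = \sum_i cst (a j i) * b i) ->
    (forall lam : 'I_c -> k, \sum_j cst (lam j) * p j = 0 -> forall j, lam j = 0) ->
  (c <= #|I|)%N.
Proof.
move=> pE ind; rewrite leqNgt; apply/negP => lt.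
pose M : 'M[k]_(c, #|I|) := \matrix_(j, i) a j (enum_val i).
have nf : kermx M != 0.
  by rewrite kermx_eq0 /row_free neq_ltn (leq_ltn_trans (rank_leq_col M)).
pose v := nz_row (kermx M).
have vM : v *m M = 0 by apply/sub_kermxP/nz_row_sub.
suff v0 j : v 0 j = 0.
  by move: nf; rewrite -nz_row_eq0 => /eqP; apply; apply/rowP => i; rewrite v0 mxE.
apply: (ind (fun j => v 0 j)).
under eq_bigr do rewrite pE mulr_sumr.
rewrite exchange_big big1 //= => i _.
under eq_bigr do rewrite mulrA -cstM.
rewrite -mulr_suml -cst_sum.
have /rowP/(_ (enum_rank i)) := vM; rewrite !mxE => e.
suff -> : \sum_j v 0 j * a j i = 0 by rewrite cst_0 mul0r.
by rewrite -[RHS]e; apply: eq_bigr => l _; rewrite mxE enum_rankK.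
Qed.

End FiniteSpan.

Section ExponentWords.
Variables (d B : nat).
Implicit Type al : {ffun 'I_d -> 'I_B}.

Definition expword al : seq 'I_d := flatten [seq nseq (al r) r | r <- enum 'I_d].

Lemma count_expword al r : count_mem r (expword al) = al r.
Proof.
rewrite count_flatten -map_comp sumnE big_map big_enum /= (bigD1 r) //=.
rewrite count_nseq /= eqxx mul1n big1 ?addn0 // => q qr.
by rewrite count_nseq /= (negbTE qr).
Qed.

Lemma size_expword al : size (expword al) = (\sum_r al r)%N.
Proof.
rewrite -sum1_size (sum_count (fun=> 1)%N); apply: eq_bigr => r _.
by rewrite muln1 count_expword.
Qed.

End ExponentWords.

(** * Normal monomials as bounded multisets of letters *)

Section NormalForms.
Variables (A : pzRingType) (d : nat) (e : A) (g : 'I_d * bool -> A).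
Local Notation iad := (iad e g).
Hypothesis gC : forall x y, g x * g y = g y * g x.
Hypothesis iadC : forall v w, iad v * iad w = iad w * iad v.
Variables (k : fieldType) (cst : k -> A).
Hypothesis cstD : forall a b, cst (a + b) = cst a + cst b.
Variables (W K : nat).

(** [inl al] stands for the iterated commutator of exponent vector [al], [inr x] for [g x].
    Exponents up to [W] suffice in weight at most [W] and keep the type finite. *)
Definition nletter := ({ffun 'I_d -> 'I_W.+1} + 'I_d * bool)%type.

Definition nletter_wt (j : nletter) : nat :=
  match j with inl al => (\sum_r al r).+1 | inr x => (x.2 : nat).+1 end.

(** [inord] keeps the multiplicities only if they are at most [W], which the weight bound
    ensures. *)
Definition wordexp (w : seq 'I_d) : {ffun 'I_d -> 'I_W.+1} :=
  [ffun r => inord (count_mem r w)].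

Lemma expwordK w : (size w <= W)%N -> perm_eq (expword (wordexp w)) w.
Proof.
move=> sw; apply/allP => r _ /=; rewrite count_expword ffunE inordK //.
by rewrite ltnS (leq_trans (count_size _ _)).
Qed.

Lemma wordexp_wt w : (size w <= W)%N -> (\sum_r wordexp w r)%N = size w.
Proof.
move=> sw; rewrite -sum1_size (sum_count (fun=> 1)%N); apply: eq_bigr => r _.
by rewrite muln1 ffunE inordK // ltnS (leq_trans (count_size _ _)).
Qed.

(* Multiplicities of the letters; the bound [2 ^ K] is immaterial once it exceeds
   [W], and makes the generating function factor as in [sum_pow2]. *)
Definition nexp := {f : {ffun nletter -> 'I_(2 ^ K)} |
  (\sum_j f j * nletter_wt j <= W)%N}.

Definition nbasis (f : nexp) : A :=
  (\prod_al iad (expword al) ^+ (val f (inl al))) * \prod_x g x ^+ (val f (inr x)).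

Hypothesis WK : (W < 2 ^ K)%N.

Lemma nmon_nbasis ws u : (nwt ws u <= W)%N ->
  exists f : nexp, nmon e g ws u = nbasis f.
Proof.
move=> h.
pose al := [seq wordexp w | w <- ws].
have sw w : w \in ws -> (size w <= W)%N.
  move=> wws; apply: ltnW; apply: leq_trans h; apply: leq_trans (leq_addr _ _).
  by rewrite (big_rem w) //= leq_addr.
have ws_al : (\sum_(w <- ws) (size w).+1 = \sum_(a <- al) (\sum_r a r).+1)%N.
  by rewrite big_map !big_seq; apply: eq_bigr => w /sw/wordexp_wt ->.
pose c (j : nletter) := match j with
  inl a => count_mem a al | inr x => count_mem x u end.
have cW : (\sum_j c j * nletter_wt j <= W)%N.
  apply: leq_trans h; rewrite /nwt ws_al big_sumType /=.
  by rewrite [X in (_ <= X + _)%N]sum_count [X in (_ <= _ + X)%N]sum_count.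
(* Every letter has positive weight, so no multiplicity exceeds [W]. *)
have cK j : (c j < 2 ^ K)%N.
  apply: leq_ltn_trans WK; apply: leq_trans cW; rewrite (bigD1 j) //=.
  by apply: leq_trans (leq_addr _ _); case: j => ?; rewrite leq_pmulr.
pose f : {ffun nletter -> 'I_(2 ^ K)} := [ffun j => Ordinal (cK j)].
have fW : (\sum_j f j * nletter_wt j <= W)%N.
  by under eq_bigr do rewrite ffunE.
exists (exist _ f fW); rewrite /nmon /nbasis /=; congr (_ * _).
  transitivity (\prod_(a <- al) iad (expword a)).
    rewrite big_map !big_seq; apply: eq_bigr => w /sw wW.
    by apply: iad_perm => //; rewrite perm_sym expwordK.
  by rewrite prod_comm_count //; apply: eq_bigr => a _; rewrite ffunE.
by rewrite prod_comm_count //; apply: eq_bigr => a _; rewrite ffunE.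
Qed.

Lemma nspan_nbasis x : nspan e g cst W x ->
  exists a : nexp -> k, x = \sum_f cst (a f) * nbasis f.
Proof.
elim=> [|a ws u z h _ [b ->]].
  by exists (fun=> 0); rewrite big1 // => f _; rewrite cst_0 // mul0r.
have [f0 ->] := nmon_nbasis h.
exists (fun f => (if f == f0 then a else 0) + b f).
under [RHS]eq_bigr do rewrite cstD mulrDl.
rewrite big_split /=; congr (_ + _); rewrite (bigD1 f0) //= eqxx big1 ?addr0 //.
by move=> f /negbTE ->; rewrite cst_0 // mul0r.
Qed.

End NormalForms.

(** * The algebra and its polynomial representation *)

Section Action.
Variables (k : fieldType) (m : nat) (V : lmodType k) (a : 'I_m -> V -> V).
Hypothesis a_lin : forall i, linear (a i).
Implicit Types p q : ncpoly k m.

Definition wact (w : seq 'I_m) (v : V) : V := foldr a v w.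
Definition pact p (v : V) : V := lin (wact^~ v) p.

Lemma wact_lin w : linear (wact w).
Proof. by elim: w => // i w IH c u v /=; rewrite IH a_lin. Qed.

Lemma wact0 w : wact w 0 = 0.
Proof.
have := wact_lin w 1 0 0; rewrite !scale1r addr0 => e.
by apply: (addrI (wact w 0)); rewrite -e addr0.
Qed.

Lemma wact_sum (I : Type) (r : seq I) (c : I -> k) (F : I -> V) w :
  wact w (\sum_(i <- r) c i *: F i) = \sum_(i <- r) c i *: wact w (F i).
Proof.
elim: r => [|i r IH]; first by rewrite !big_nil wact0.
by rewrite !big_cons wact_lin IH.
Qed.

Lemma pact_mul p q v : pact (ncmul p q) v = pact p (pact q v).
Proof.
rewrite /pact lin_mul; apply: eq_lin => u.
rewrite {2}/lin wact_sum; apply: eq_bigr => t _.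
by rewrite /wact foldr_cat.
Qed.

Lemma pact_cat p q v : pact (p ++ q) v = pact p v + pact q v.
Proof. exact: lin_cat. Qed.

Lemma pact_scale c p v : pact (ncscale c p) v = c *: pact p v.
Proof. exact: lin_scale. Qed.

Lemma pact_gen i v : pact [:: (1, [:: i])] v = a i v.
Proof. by rewrite /pact /lin big_seq1 scale1r. Qed.

Lemma pact0 p : pact p 0 = 0.
Proof.
by rewrite /pact /lin big1 // => t _; rewrite wact0 scaler0.
Qed.

Lemma pact_ideal (rels : seq (ncpoly k m)) :
    (forall p v, p \in rels -> pact p v = 0) ->
  forall p v, in_ideal rels p -> pact p v = 0.
Proof.
move=> H p v [ts [/allP tsr e]]; rewrite /pact (lin_eqcoef _ e) lin_flatten.
rewrite big_map big_seq big1 // => t /tsr tr.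
by rewrite -!/(pact _ _) !pact_mul (H _ _ tr) pact0.
Qed.

End Action.

(** * Generators and relations *)

Section Presentation.
Variables (k : fieldType) (d : nat).

(** [None] is [e], [Some (r, false)] is t_r and [Some (r, true)] is s_r. *)
Definition letter := option ('I_d * bool).
Definition ngens : nat := #|{: letter}|.

Definition ncgen (x : letter) : ncpoly k ngens := [:: (1, [:: enum_rank x])].
Definition ncsub m (p q : ncpoly k m) : ncpoly k m := p ++ ncscale (-1) q.
Definition ncbr m (p q : ncpoly k m) : ncpoly k m := ncsub (ncmul p q) (ncmul q p).

Fixpoint nciad (w : seq 'I_d) : ncpoly k ngens :=
  if w is r :: w' then ncbr (ncgen (Some (r, false))) (nciad w') else ncgen None.

Definition alg_rels : seq (ncpoly k ngens) :=
  [seq ncbr (ncgen (Some x)) (ncgen (Some y)) | x <- enum {: 'I_d * bool},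
     y <- enum {: 'I_d * bool}]
  ++ [seq ncsub (ncbr (ncgen (Some (r, true))) (ncgen None))
        (ncmul (nciad [:: r]) (ncgen (Some (r, false)))) | r <- enum 'I_d]
  ++ [seq ncbr (nciad (enum U)) (nciad (enum V)) | U : {set 'I_d} <- enum {set 'I_d},
     V : {set 'I_d} <- enum {set 'I_d}].

(** Homogeneity gives the exact degree of the products used for the lower bound. *)
Lemma size_nciad w t : t \in nciad w -> size t.2 = (size w).+1.
Proof.
elim: w t => [|r w IH] t /=; first by rewrite inE => /eqP ->.
rewrite /ncbr /ncsub mem_cat => /orP[|/mapP[t' + ->]] /=.
  case/allpairsP => -[x y] /= [+ /IH yw ->] /=; rewrite inE => /eqP-> /=.
  by rewrite yw.
case/allpairsP => -[x y] /= [/IH xw + ->] /=; rewrite inE size_cat => /eqP-> /=.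
by rewrite xw addn1.
Qed.

Definition ncprod (ps : seq (ncpoly k ngens)) : ncpoly k ngens :=
  foldr (@ncmul k ngens) [:: (1, [::])] ps.

Lemma size_ncprod_iad (ws : seq (seq 'I_d)) t :
  t \in ncprod [seq nciad w | w <- ws] -> size t.2 = (\sum_(w <- ws) (size w).+1)%N.
Proof.
elim: ws t => [|w ws IH] t /=; first by rewrite inE big_nil => /eqP ->.
case/allpairsP => -[x y] /= [/size_nciad + /IH + ->] /=.
by rewrite size_cat big_cons => -> ->.
Qed.

End Presentation.

(** * The representation on polynomials in the box variables *)

Section Model.
Variables (k : fieldType) (d L : nat).
Local Notation T := {ffun 'I_d -> 'I_L}.
Local Notation P := {mpoly k[#|T|]}.

(* The variable indexed by the exponent vector of [w], or [0] outside the box. *)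
Definition wvar (w : seq 'I_d) : P :=
  \sum_(al : T | [forall r, al r == count_mem r w :> nat]) 'X_(enum_rank al).

Lemma wvar_count v w : (forall r, count_mem r v = count_mem r w) -> wvar v = wvar w.
Proof. by move=> vw; apply: eq_bigl => al; apply: eq_forallb => r; rewrite vw. Qed.

Lemma wvar_expword (al : T) : wvar (expword al) = 'X_(enum_rank al).
Proof.
rewrite /wvar (big_pred1 al) // => be; apply/forallP/eqP => [H|-> r].
  by apply/ffunP => r; apply: val_inj; rewrite /= (eqP (H r)) count_expword.
by rewrite count_expword.
Qed.

(** The substitution is multiplicative, so its coefficients obey product rules: those of z and z^2
    are the relations of t_r and s_r with the e_w, in any characteristic. *)
Definition shift (r : 'I_d) : P -> {poly P} :=
  mmap (polyC \o @mpolyC _ k) (fun i =>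
    ('X_i)%:P + 'X * (wvar (r :: expword (enum_val i)))%:P).
HB.instance Definition _ r := GRing.RMorphism.on (shift r).

Lemma shift_wvar r w : shift r (wvar w) = (wvar w)%:P + 'X * (wvar (r :: w))%:P.
Proof.
have [al alw|none] := pickP (fun al : T => [forall r, al r == count_mem r w :> nat]).
  have cw q : count_mem q w = count_mem q (expword al).
    by rewrite count_expword; apply/esym/eqP/(forallP alw).
  rewrite (wvar_count cw) (@wvar_count (r :: w) (r :: expword al)).
    by rewrite wvar_expword /shift mmapX mmap1U enum_rankK.
  by move=> q /=; rewrite cw.
(* Outside the box both [wvar w] and [wvar (r :: w)] vanish, as adding a letter cannot lead back
   into it. *)
rewrite /wvar !big_pred0 ?raddf0 ?mulr0 ?addr0 // => be.
apply/negbTE/forallP => H; have lt q : (count_mem q w < L)%N.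
  apply: leq_ltn_trans (ltn_ord (be q)).
  by rewrite (eqP (H q)) /= leq_addl.
move: (none [ffun q => Ordinal (lt q)]) => /forallP[] q.
by rewrite ffunE.
Qed.

(* Locked: unification would otherwise unfold the polynomial substitution. *)
Fact dop_key : unit. Proof. by []. Qed.
Definition dop : 'I_d * bool -> P -> P :=
  locked_with dop_key (fun (x : 'I_d * bool) f => (shift x.1 f)`_(x.2 : nat).+1).

Lemma dopE x f : dop x f = (shift x.1 f)`_(x.2 : nat).+1.
Proof. by rewrite /dop locked_withE. Qed.

(** Peeling off one variable at a time suits the product rules [dop_t] and [dop_s]. *)
Lemma mpoly_gen_ind (Q : P -> Prop) :
    Q 1 -> (forall f i, Q f -> Q ('X_i * f)) ->
    (forall c f g, Q f -> Q g -> Q (c *: f + g)) -> forall f, Q f.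
Proof.
move=> Q1 QX Qlin.
have Q0 : Q 0 by have := Qlin (-1) _ _ Q1 Q1; rewrite scaleN1r addNr.
elim/mpolyind => // c m p _ _ Qp; apply: Qlin => //; rewrite mpolyXE_id.
elim/big_rec: _ => // i x _ Qx.
by elim: (m i) => [|j IH]; rewrite ?expr0 ?mul1r // exprS -mulrA; apply: QX.
Qed.

Lemma shift0 r f : (shift r f)`_0 = f.
Proof.
elim/mpoly_gen_ind: f => [|f i IH|c f g IHf IHg].
- by rewrite rmorph1 coefC.
- rewrite rmorphM /= -(enum_valK i) -wvar_expword shift_wvar.
  by rewrite coef0M IH coefD coefC coefXM addr0.
- by rewrite raddfD /= /shift mmapZ coefD IHg /= coefCM IHf mul_mpolyC.
Qed.

Lemma dop_lin x : linear (dop x).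
Proof.
move=> c f g; rewrite !dopE raddfD /= {1}/shift mmapZ coefD /= coefCM.
by rewrite mul_mpolyC.
Qed.

Lemma dop1 x : dop x 1 = 0.
Proof. by rewrite !dopE rmorph1 coefC. Qed.

Lemma dop_t r w f :
  dop (r, false) (wvar w * f) = wvar w * dop (r, false) f + wvar (r :: w) * f.
Proof.
rewrite !dopE rmorphM /= shift_wvar mulrDl coefD coefCM -mulrA coefXM /= coefCM.
by rewrite shift0.
Qed.

Lemma dop_s r w f :
  dop (r, true) (wvar w * f) = wvar w * dop (r, true) f + wvar (r :: w) * dop (r, false) f.
Proof. by rewrite !dopE rmorphM /= shift_wvar mulrDl coefD coefCM -mulrA coefXM /= coefCM. Qed.

Lemma dopD x f g : dop x (f + g) = dop x f + dop x g.
Proof. by have := dop_lin x 1 f g; rewrite !scale1r. Qed.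

Lemma dop0 x : dop x 0 = 0.
Proof. by apply: (addrI (dop x 0)); rewrite -dopD !addr0. Qed.

(** On a product by a variable, the product rules expand both sides into the same terms, since
    [wvar] ignores the order of letters and the operators commute on the cofactor by induction. *)
Lemma dopC f x y : dop x (dop y f) = dop y (dop x f).
Proof.
elim/mpoly_gen_ind: f x y => [|f i IH|c f g IHf IHg] x y; last first.
- rewrite (dop_lin y c f g) (dop_lin x c f g).
  by rewrite (dop_lin x c (dop y f)) (dop_lin y c (dop x f)) IHf IHg.
- have sw r q w : wvar (r :: q :: w) = wvar (q :: r :: w).
    by apply: wvar_count => j /=; rewrite addnCA.
  rewrite -(enum_valK i) -wvar_expword; move: (expword _) => w.
  case: x y => r [] [q []]; rewrite !(dop_t, dop_s, dopD) !(IH (r, _) (q, _)) (sw r q); ring.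
- by rewrite !dop1 !dop0.
Qed.

Definition gact (i : 'I_(ngens d)) : P -> P :=
  if enum_val i is Some x then dop x else fun f => wvar [::] * f.

Lemma gact_lin i : linear (gact i).
Proof.
rewrite /gact; case: (enum_val i) => [x|]; first exact: dop_lin.
by move=> c u v; rewrite mulrDr scalerAr.
Qed.

Local Notation act := (pact gact).

Lemma act_gen x f : act (ncgen k x) f = if x is Some y then dop y f else wvar [::] * f.
Proof. by rewrite /ncgen pact_gen /gact enum_rankK; case: x. Qed.

Lemma act_sub p q f : act (ncsub p q) f = act p f - act q f.
Proof. by rewrite pact_cat pact_scale scaleN1r. Qed.

Lemma act_br p q f : act (ncbr p q) f = act p (act q f) - act q (act p f).
Proof. by rewrite act_sub !(pact_mul gact_lin). Qed.

(** By the product rule, the bracket of t_r with multiplication by [wvar w] is multiplication by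
    [wvar (r :: w)]. *)
Lemma act_iad w f : act (nciad k w) f = wvar w * f.
Proof.
elim: w f => [|r w IH] f; first by rewrite act_gen.
by rewrite act_br !IH !act_gen dop_t addrC addKr.
Qed.

Lemma act_rels p f : p \in alg_rels k d -> act p f = 0.
Proof.
rewrite !mem_cat => /or3P[/allpairsP[[x y] /= [_ _ ->]] | /mapP[r _ ->]
  | /allpairsP[[U V] /= [_ _ ->]]].
- by rewrite act_br !act_gen dopC subrr.
- rewrite act_sub act_br (pact_mul gact_lin) act_iad !act_gen dop_s.
  by ring.
- by rewrite act_br !act_iad mulrCA subrr.
Qed.

Definition subset_elt (S : {set T}) : ncpoly k (ngens d) :=
  ncprod [seq nciad k (expword al) | al <- enum S].

Definition subset_mnm (S : {set T}) : 'X_{1..#|T|} :=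
  [multinom (enum_val i \in S : nat) | i < #|T|].

Lemma subset_mnm_inj : injective subset_mnm.
Proof.
move=> S S' /mnmP e; apply/setP => al.
have := e (enum_rank al); rewrite !mnmE !enum_rankK.
by case: (al \in S); case: (al \in S').
Qed.

Lemma act_subset S : act (subset_elt S) 1 = 'X_[subset_mnm S].
Proof.
transitivity (\prod_(al in S) ('X_(enum_rank al) : P)).
  rewrite -big_enum /subset_elt /=; elim: (enum S) => [|al s IH].
    by rewrite big_nil /pact /lin big_seq1 scale1r.
  by rewrite big_cons /= (pact_mul gact_lin) IH act_iad wvar_expword.
rewrite mpolyXE_id big_mkcond (reindex (@enum_val T T)) /=; last first.
  by apply: onW_bij; apply: enum_val_bij.
apply: eq_bigr => i _; rewrite mnmE enum_valK.
by case: (_ \in S); rewrite ?expr1 ?expr0.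
Qed.

(** The hypothesis bounds the degree of the product over the whole box, hence over each subset;
    acting on 1 separates the subsets by monomials. *)
Lemma subset_indep n : (\sum_(al : T) (\sum_r al r).+1 <= n)%N ->
  indep_in_Xn (alg_rels k d) n #|{set T}|.
Proof.
move=> h; exists (fun j => subset_elt (enum_val j)); split.
  move=> j; apply/allP => t; rewrite /subset_elt map_comp => /size_ncprod_iad ->.
  rewrite big_map big_enum /=; apply: leq_trans h.
  by rewrite big_mkcond leq_sum // => al _; case: ifP => // _; rewrite size_expword.
move=> lam /(@pact_ideal _ _ _ _ gact_lin _ act_rels _ 1).
rewrite /pact lin_flatten big_map big_enum /= => e j.
have := congr1 (mcoeff (subset_mnm (enum_val j))) e.
rewrite mcoeff0 raddf_sum /= (bigD1 j) //= big1 ?addr0.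
  rewrite -/(pact _ _ _) pact_scale act_subset mcoeffZ mcoeffX eqxx mulr1 //.
move=> i ij; rewrite -/(pact _ _ _) pact_scale act_subset mcoeffZ mcoeffX.
by rewrite (inj_eq subset_mnm_inj) (inj_eq enum_val_inj) (negbTE ij) mulr0.
Qed.

End Model.

(* Otherwise the argument of [exp] is parsed in [R_scope], where the ring lemmas
   do not apply. *)
Local Arguments exp : clear scopes.
(** * Counting normal forms *)

(** Binary expansion of the exponent, splitting off the top bit. *)
Lemma sum_pow2 (F : comPzRingType) (u : F) K :
  \sum_(m < 2 ^ K) u ^+ m = \prod_(i < K) (1 + u ^+ (2 ^ i)).
Proof.
elim: K => [|K IH]; first by rewrite big_ord_recl !big_ord0 expr0 addr0.
rewrite big_ord_recr /= -IH expnS mul2n -addnn big_split_ord /= mulrDr mulr1.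
by congr (_ + _); rewrite mulr_suml; apply: eq_bigr => i _; rewrite exprD mulrC.
Qed.

(** In the expanded product every multiset contributes z to its weight, which is at least [z ^+ W]
    when the weight is at most [W]. *)
Lemma card_nexp_le (F : realFieldType) (d W K : nat) (z : F) : 0 < z <= 1 ->
  #|{: nexp d W K}|%:R * z ^+ W <=
    \prod_j \prod_(i < K) (1 + z ^+ (@nletter_wt d W j * 2 ^ i)).
Proof.
case/andP=> z0 z1.
have -> : \prod_j \prod_(i < K) (1 + z ^+ (@nletter_wt d W j * 2 ^ i)) =
    \sum_(f : {ffun nletter d W -> 'I_(2 ^ K)}) \prod_j (z ^+ nletter_wt j) ^+ f j.
  rewrite -(bigA_distr_bigA (fun j m => (z ^+ nletter_wt j) ^+ nat_of_ord m)) /=.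
  by apply: eq_bigr => j _; rewrite sum_pow2; apply: eq_bigr => i _; rewrite exprM.
rewrite card_sig mulr_natl -sumr_const big_mkcond /=; apply: ler_sum => f _.
have -> : \prod_j (z ^+ nletter_wt j) ^+ f j = z ^+ (\sum_j f j * nletter_wt j).
  by rewrite -prodrXr; apply: eq_bigr => j _; rewrite mulnC exprM.
case: ifP => [fW|_]; last by rewrite exprn_ge0 // ltW.
by apply: ler_wiXn2l => //; rewrite ltW.
Qed.

Lemma Rexp_ge1x (x : R) : 1 + x <= exp x.
Proof.
apply/RleP; have [->|/eqP xN] := eqVneq x 0; first by rewrite addr0 exp_0; apply: Rle_refl.
exact/Rlt_le/exp_ineq1.
Qed.

Lemma Rexp_gt0 (x : R) : 0 < exp x.
Proof. exact/RltP/exp_pos. Qed.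

Lemma RexpD (x y : R) : exp (x + y) = exp x * exp y.
Proof. exact: exp_plus. Qed.

Lemma Rexp_sum (I : Type) (r : seq I) (F : I -> R) :
  exp (\sum_(i <- r) F i) = \prod_(i <- r) exp (F i).
Proof. exact: (big_morph exp exp_plus exp_0). Qed.

Lemma RexpX (x : R) n : exp x ^+ n = exp (n%:R * x).
Proof. by rewrite expRX mulr_natl. Qed.

Lemma Rexp_le (x y : R) : x <= y -> exp x <= exp y.
Proof.
by rewrite le_eqVlt => /predU1P[-> // | /RltP/exp_increasing/RltP/ltW].
Qed.

Lemma prod_1D_le_exp (I : finType) (F : I -> R) : (forall i, 0 <= F i) ->
  \prod_i (1 + F i) <= exp (\sum_i F i).
Proof.
move=> F0; rewrite Rexp_sum; apply: ler_prod => i _.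
by rewrite addr_ge0 //= Rexp_ge1x.
Qed.

(* [q / (1 - q) <= 1 / x] for [q = exp (- x)] *)
Lemma geom_exp_le (x : R) n : 0 < x -> \sum_(a < n) exp (- x) ^+ a.+1 <= x^-1.
Proof.
move=> x0; set q := exp (- x); have q0 : 0 < q by apply: Rexp_gt0.
have xq : x * q <= 1 - q.
  have h : (1 + x) * q <= exp x * q by rewrite ler_wpM2r ?Rexp_ge1x // ltW.
  have e : exp x * q = 1 by rewrite -RexpD addrN expR0.
  by rewrite e in h; lra.
have : (1 - q) * \sum_(a < n) q ^+ a.+1 <= q.
  have -> : (1 - q) * \sum_(a < n) q ^+ a.+1 = q * (1 - q ^+ n).
    rewrite -opprB mulNr [1 - q ^+ n](_ : _ = - (q ^+ n - 1)); last by rewrite opprB.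
    rewrite subrX1 mulrN; congr (- _); rewrite mulrCA; congr (_ * _).
    by rewrite mulr_sumr; apply: eq_bigr => i _; rewrite exprS.
  by have := exprn_ge0 n (ltW q0); nra.
set G := \sum_(a < n) _ => GQ.
have G0 : 0 <= G by apply: sumr_ge0 => i _; rewrite exprn_ge0 // ltW.
have : x * q * G <= q by apply: le_trans GQ; rewrite ler_wpM2r.
rewrite mulrAC -{2}[q]mul1r ler_pM2r // => h.
by rewrite -[X in _ <= X]mul1r ler_pdivlMr // mulrC.
Qed.

(** As [sum_r (al r + 1)] is at most [d] times the weight of [al], the sum over vectors is bounded
    by a product of [d] geometric sums at [x / d]. Each of the other [2 d] letters is one term of a
    geometric sum at [x]. *)
Lemma sum_letters_le (d W : nat) (x : R) : (0 < d)%N -> 0 < x ->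
  \sum_j exp (- x) ^+ @nletter_wt d W j <= (d%:R / x) ^+ d + (2 * d)%:R / x.
Proof.
move=> d0 x0; rewrite big_sumType /=; apply: lerD.
  have d0' : 0 < d%:R :> R by rewrite ltr0n.
  apply: (@le_trans _ _ (\sum_(al : {ffun 'I_d -> 'I_W.+1})
      \prod_r exp (- (x / d%:R)) ^+ (al r).+1)).
    apply: ler_sum => al _; rewrite prodrXr !RexpX; apply: Rexp_le.
    rewrite !mulrN lerN2 mulrCA [X in _ <= X]mulrC ler_pM2l // ler_pdivrMr //.
    rewrite -natrM ler_nat mulSn -{1}[in X in (_ <= X)%N](card_ord d).
    under eq_bigr do rewrite -addn1.
    by rewrite big_split /= sum1_card addnC leq_add2l leq_pmulr.
  rewrite -(bigA_distr_bigA (fun r (a : 'I_W.+1) => exp (- (x / d%:R)) ^+ a.+1)) /=.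
  rewrite prodr_const card_ord; apply: lerXn2r; rewrite ?nnegrE.
  - by apply: sumr_ge0 => a _; rewrite exprn_ge0 // ltW // Rexp_gt0.
  - by rewrite divr_ge0 // ltW.
  - by rewrite -[X in _ <= X]invf_div; apply: geom_exp_le; rewrite divr_gt0.
apply: (@le_trans _ _ (\sum_(y : 'I_d * bool) x^-1)).
  apply: ler_sum => y _; apply: le_trans (geom_exp_le (y.2 : nat).+1 x0).
  rewrite big_ord_recr /= lerDr; apply: sumr_ge0 => i _.
  by rewrite exprn_ge0 // ltW // Rexp_gt0.
by rewrite sumr_const card_prod card_ord card_bool mulnC mulr_natl.
Qed.

Lemma card_nexp_exp (d W K : nat) (y : R) : (0 < d)%N -> 0 < y <= 1 ->
  #|{: nexp d W K}|%:R <= exp (W%:R * y + 2 * (d ^ d + 2 * d)%:R / y ^+ d).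
Proof.
move=> d0 /andP[y0 y1]; set C := (d ^ d + 2 * d)%N.
have z0 : 0 < exp (- y) by apply: Rexp_gt0.
have z1 : exp (- y) <= 1 by rewrite -expR0; apply: Rexp_le; rewrite oppr_le0 ltW.
have := @card_nexp_le _ d W K (exp (- y)); rewrite z0 z1 => /(_ isT) h.
have yd : 0 < y ^+ d by rewrite exprn_gt0.
have ydV : 0 <= y ^- d by rewrite invr_ge0 ltW.
have S : \sum_(i < K) \sum_j exp (- y) ^+ (@nletter_wt d W j * 2 ^ i) <=
    2 * C%:R / y ^+ d.
  (* The i-th inner sum is [sum_letters_le] at [2 ^+ i * y]; as [d >= 1] and [y <= 1], it decays
     like [2^-i / y^d], and the total costs a factor 2. *)
  apply: (@le_trans _ _ (\sum_(i < K) C%:R / y ^+ d * (2^-1) ^+ i)).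
    apply: ler_sum => i _; have p0 : 0 < 2 ^+ i :> R by rewrite exprn_gt0.
    have p1 : 1 <= 2 ^+ i :> R by apply: exprn_ege1; lra.
    have yi0 : 0 < 2 ^+ i * y by rewrite mulr_gt0.
    have := sum_letters_le W d0 yi0.
    under eq_bigr => j _ do rewrite -mulrN -natrX -RexpX -exprM mulnC.
    move/le_trans; apply.
    rewrite /C natrD mulrDl mulrDl; apply: lerD.
      rewrite expr_div_n [(d ^ d)%:R]natrX -mulrA ler_wpM2l ?exprn_ge0 ?ler0n //.
      rewrite exprMn invfM.
      rewrite mulrC ler_wpM2l // exprVn lef_pV2 ?posrE ?exprn_gt0 //.
      by rewrite -{1}[2 ^+ i]expr1 ler_weXn2l.
    rewrite -!mulrA ler_wpM2l ?ler0n // invfM mulrC exprVn ler_wpM2r //.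
      by rewrite invr_ge0 ltW.
    rewrite lef_pV2 ?posrE // -{2}[y]expr1.
    by apply: ler_wiXn2l => //; rewrite ltW.
  rewrite -mulr_sumr [X in _ <= X](_ : _ = C%:R / y ^+ d * 2); last by ring.
  apply: ler_wpM2l; first by rewrite mulr_ge0 ?ler0n.
  suff -> : \sum_(i < K) 2^-1 ^+ i = 2 - 2 * 2^-1 ^+ K :> R.
    have : 0 < 2^-1 ^+ K :> R by rewrite exprn_gt0 // invr_gt0.
    lra.
  elim: (K) => [|j IH]; first by rewrite big_ord0 expr0; lra.
  by rewrite big_ord_recr /= IH exprS; lra.
have P : \prod_j \prod_(i < K) (1 + exp (- y) ^+ (@nletter_wt d W j * 2 ^ i)) <=
    exp (2 * C%:R / y ^+ d).
  apply: le_trans (Rexp_le S); rewrite exchange_big Rexp_sum /=.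
  apply: ler_prod => i _; apply/andP; split.
    by apply: prodr_ge0 => j _; rewrite addr_ge0 // exprn_ge0 // ltW.
  by apply: prod_1D_le_exp => j; rewrite exprn_ge0 // ltW.
move: (le_trans h P); rewrite RexpX => H.
have e : exp (W%:R * - y) * exp (W%:R * y) = 1.
  by rewrite -RexpD -mulrDr addNr mulr0 expR0.
rewrite RexpD [X in _ <= X]mulrC -[X in X <= _]mulr1 -[X in _ * X <= _]e mulrA.
by rewrite ler_wpM2r // ltW // Rexp_gt0.
Qed.

(** * Asymptotics *)

Definition rp (d n : nat) : R := Rpower (INR n) (Rdiv (INR d) (INR d.+1)).

(** With [l] the (d+1)-st root of [n], estimates on [rp] become comparisons of natural powers. *)
Lemma rp_root d n : (0 < n)%N ->
  exists l : R, [/\ 1 <= l, l ^+ d.+1 = n%:R & rp d n = l ^+ d].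
Proof.
move=> n0; have n0' : Rlt 0 (INR n) by apply: lt_0_INR; apply/ssrnat.ltP.
have d0 : INR d.+1 <> 0 by rewrite INRE; apply/eqP; rewrite pnatr_eq0.
pose l := Rpower (INR n) (Rinv (INR d.+1)).
have l0 : Rlt 0 l by apply: exp_pos.
have lX : l ^+ d.+1 = n%:R.
  rewrite -RpowE -Rpower_pow // Rpower_mult Rinv_l // Rpower_1 //.
  exact: INRE.
exists l; split=> //.
  have : (1 : R) ^+ d.+1 <= l ^+ d.+1 by rewrite lX expr1n ler1n.
  by rewrite ler_pXn2r // nnegrE ltW //; apply/RltP.
rewrite -RpowE -Rpower_pow // Rpower_mult /rp; congr Rpower.
by rewrite [LHS]Rmult_comm.
Qed.

(** The value is 1 and not 0, because [ln] is 0 outside the positive reals. *)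
Lemma rp0 d : rp d 0 = 1.
Proof.
rewrite /rp /Rpower /= /ln; case: Rlt_dec => [/Rlt_irrefl //|_].
by rewrite Rmult_0_r exp_0.
Qed.

Lemma rp_ge1 d n : 1 <= rp d n.
Proof.
case: n => [|n]; first by rewrite rp0.
by have [l [l1 _ ->]] := @rp_root d n.+1 isT; apply: exprn_ege1.
Qed.

Lemma rp_leq d n m : (n <= m)%N -> rp d n <= rp d m.
Proof.
case: n => [|n] nm; first by rewrite rp0 rp_ge1.
have [l [l1 lX ->]] := @rp_root d n.+1 isT.
have [l' [l1' lX' ->]] := @rp_root d m (leq_trans (ltn0Sn n) nm).
have : l ^+ d.+1 <= l' ^+ d.+1 by rewrite lX lX' ler_nat.
have l0 : 0 <= l by lra.
have l0' : 0 <= l' by lra.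
rewrite ler_pXn2r // => ll; exact: lerXn2r.
Qed.

Lemma rp_le1D d n : rp d n <= 1 + n%:R.
Proof.
case: n => [|n]; first by rewrite rp0 addr0.
have [l [l1 <- ->]] := @rp_root d n.+1 isT.
by rewrite (le_trans (ler_weXn2l l1 (leqnSn d))) // lerDr.
Qed.

(** [2 d >= d + 1]. *)
Lemma rp_sqr d n : (0 < d)%N -> n%:R <= rp d n ^+ 2.
Proof.
move=> d0; case: n => [|n]; first by rewrite rp0 expr1n.
have [l [l1 <- ->]] := @rp_root d n.+1 isT.
by rewrite -exprM; apply: ler_weXn2l => //; rewrite muln2 -addnn -addn1 leq_add2l.
Qed.

Lemma rp_mulX d D N : (0 < D)%N -> (0 < N)%N -> rp d (D * N ^ d.+1) <= (D * N)%:R ^+ d.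
Proof.
move=> D0 N0; have [|l [l1 lX ->]] := @rp_root d (D * N ^ d.+1).
  by rewrite muln_gt0 D0 expn_gt0 N0.
have l0 : 0 <= l by lra.
apply: lerXn2r; rewrite ?nnegrE ?ler0n // -(@ler_pXn2r _ d.+1) ?nnegrE ?ler0n //.
rewrite lX -natrX ler_nat expnMn leq_mul2r -{1}[D]expn1 leq_pexp2l ?orbT //.
Qed.

(** This moves a factor in the exponent into the argument; [A ^ 2] is enough because [2 d >= d + 1].
    The summand [A] pays for [n = 0], where [rp] is 1. *)
Lemma rp_scale d A n : (0 < d)%N -> (0 < A)%N -> A%:R * rp d n <= rp d (A ^ 2 * n) + A%:R.
Proof.
move=> d0 A0; case: n => [|n].
  by rewrite rp0 mulr1 lerDr (le_trans _ (rp_ge1 _ _)).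
have [l [l1 lX ->]] := @rp_root d n.+1 isT.
have [|l' [l1' lX' ->]] := @rp_root d (A ^ 2 * n.+1).
  by rewrite muln_gt0 expn_gt0 A0.
have l0 : 0 <= l by lra.
have l0' : 0 <= l' by lra.
suff : A%:R * l ^+ d <= l' ^+ d by have : 0 <= A%:R :> R by []; lra.
rewrite -(@ler_pXn2r _ d.+1) ?nnegrE ?mulr_ge0 ?exprn_ge0 //.
rewrite exprMn -!exprM mulnC !exprM lX lX' natrM exprMn.
rewrite ler_wpM2r ?exprn_ge0 // -!natrX ler_nat -expnM leq_pexp2l //.
by rewrite mul2n -addnn -addn1 leq_add2l.
Qed.

Lemma Rexp1_le4 : exp 1 <= 4.
Proof.
apply: (@le_trans _ _ 3); last by lra.
have /RleP := exp_le_3; rewrite [IZR 3](_ : _ = 3) // -[IZR 3]/(INR 3).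
Qed.

Lemma Rexp_nat_le n : exp n%:R <= (4 ^ n)%:R.
Proof.
rewrite -[n%:R]mulr1 -RexpX natrX; apply: lerXn2r; rewrite ?nnegrE //.
  exact/ltW/Rexp_gt0.
exact: Rexp1_le4.
Qed.

(** [exp (1/2) <= 2], because [exp 1 <= 4]. *)
Lemma pow2_ge_exp (x : R) n : 2 * x <= n%:R -> exp x <= (2 ^ n)%:R.
Proof.
move=> h; apply: (@le_trans _ _ (exp (n%:R * 2^-1))); first by apply: Rexp_le; lra.
rewrite -RexpX natrX; apply: lerXn2r; rewrite ?nnegrE ?(ltW (Rexp_gt0 _)) //.
rewrite -(@ler_pXn2r _ 2) ?nnegrE ?(ltW (Rexp_gt0 _)) // RexpX mulfV ?pnatr_eq0 //.
by apply: le_trans Rexp1_le4 _; lra.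
Qed.

(** The m-th power of [x / m <= exp (x / m)]. *)
Lemma pow_le_exp (x : R) m : 0 <= x -> x ^+ m <= (m ^ m)%:R * exp x.
Proof.
case: m => [|m] x0.
  by rewrite expr0 mul1r (le_trans _ (Rexp_ge1x x)) // lerDl.
have m0 : m.+1%:R != 0 :> R by rewrite pnatr_eq0.
have -> : exp x = exp (x / m.+1%:R) ^+ m.+1 by rewrite RexpX mulrC divfK.
rewrite natrX -exprMn; apply: lerXn2r; rewrite ?nnegrE //.
  by rewrite mulr_ge0 // ltW // Rexp_gt0.
rewrite -ler_pdivrMl ?ltr0n // mulrC; apply: le_trans (Rexp_ge1x _).
by rewrite lerDr.
Qed.

(** The choice [y = 1 / l] balances the two terms of [card_nexp_exp]: both [n y] and [1 / y^d] equal
    [l^d]. *)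
Lemma card_nexp_rp d n : (0 < d)%N -> (0 < n)%N ->
  #|{: nexp d (n * 2) (n * 2)}|%:R <= exp ((2 + 2 * (d ^ d + 2 * d))%:R * rp d n).
Proof.
move=> d0 n0; have [l [l1 lX ->]] := @rp_root d n n0.
have l0 : 0 < l by lra.
have y01 : 0 < l^-1 <= 1 by rewrite invr_gt0 l0 invf_le1.
apply: le_trans (card_nexp_exp _ _ d0 y01) _; apply: Rexp_le.
rewrite natrM -lX exprS exprVn invrK; set c := (d ^ d + _)%N.
have -> : (2 + 2 * c)%:R = 2 + 2 * c%:R :> R by rewrite natrD natrM.
rewrite le_eqVlt; apply/orP; left; apply/eqP; field.
exact: lt0r_neq0.
Qed.

Lemma box_weight d L : (0 < d)%N ->
  (\sum_(al : {ffun 'I_d -> 'I_L}) (\sum_r al r).+1 <= d * L ^ d.+1)%N.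
Proof.
move=> d0; apply: (@leq_trans (\sum_(al : {ffun 'I_d -> 'I_L}) d * L)).
  apply: leq_sum => al _; apply: (@leq_trans (\sum_(r : 'I_d) (al r).+1)).
    under [X in (_ <= X)%N]eq_bigr do rewrite -addn1.
    by rewrite big_split /= sum1_card card_ord -addn1 leq_add2l.
  apply: (@leq_trans (\sum_(r : 'I_d) L)); first exact: leq_sum.
  by rewrite sum_nat_const card_ord.
by rewrite sum_nat_const card_ffun !card_ord mulnCA expnSr.
Qed.

(** Take the least [L] with [L >= 2 n^(1/(d+1))], the 2 being the one in [pow2_ge_exp]; minimality
    and [L <= 2 (L - 1)] cost another factor 2. *)
Lemma box_size d n : (0 < n)%N ->
  exists L, (2 ^ d.+1 * n <= L ^ d.+1 <= 4 ^ d.+1 * n)%N.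
Proof.
move=> n0; have ex : exists L, (2 ^ d.+1 * n <= L ^ d.+1)%N.
  exists (2 * n)%N; rewrite expnMn leq_mul2l -{1}[n]expn1 leq_pexp2l ?orbT //.
have [L hL Lmin] := ex_minnP ex; exists L; rewrite hL /=.
have L0 : (0 < L)%N.
  case: L hL {Lmin} => //; rewrite exp0n // leqn0 muln_eq0 expn_eq0 /=.
  by case: n n0 {ex}.
have [L1|L1] := leqP L 1.
  by apply: (@leq_trans 1); rewrite ?muln_gt0 ?expn_gt0 ?n0 // -(exp1n d.+1) leq_exp2r.
have /leqW : (L.-1 ^ d.+1 < 2 ^ d.+1 * n)%N.
  by rewrite ltnNge; apply/negP => /Lmin; rewrite leqNgt prednK // leqnn.
rewrite ltnS => h.
apply: (@leq_trans ((2 * L.-1) ^ d.+1)); first by rewrite leq_exp2r //; lia.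
by rewrite expnMn (_ : 4%N = 2 * 2)%N // [X in (_ <= X * _)%N]expnMn -mulnA leq_mul2l h orbT.
Qed.

(** * From the counting bounds to the growth type *)

Section GrowthType.
Variables (d : nat) (gamma : nat -> nat).
Hypothesis d0 : (0 < d)%N.
Hypothesis gamma_le : forall n, (gamma n <= #|{: nexp d (n * 2) (n * 2)}|)%N.
Hypothesis gamma_ge : forall n L,
  (\sum_(al : {ffun 'I_d -> 'I_L}) (\sum_r al r).+1 <= n)%N ->
  (2 ^ (L ^ d) <= gamma n)%N.

Lemma gamma0 : (0 < gamma 0)%N.
Proof.
apply: leq_trans (gamma_ge (L := 0) _); first by rewrite expn_gt0.
by rewrite (leq_trans (box_weight _ d0)) // exp0n // muln0.
Qed.

Lemma growth_le : exists C, forall n, (gamma n)%:R <= C%:R * exp (rp d (C * n)).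
Proof.
pose A := (2 + 2 * (d ^ d + 2 * d))%N.
(* [A ^ 2] scales the argument, [4 ^ A] dominates [exp A], and [gamma 0] handles [n = 0]. *)
exists (A ^ 2 + 4 ^ A + gamma 0)%N => n; set C := (_ + gamma 0)%N.
have C0 : 0 <= C%:R :> R by [].
have [->|n0] := posnP n.
  rewrite muln0 rp0; apply: (@le_trans _ _ C%:R); first by rewrite ler_nat leq_addl.
  rewrite -{1}[C%:R]mulr1 ler_wpM2l // (le_trans _ (Rexp_ge1x _)) //; lra.
apply: (@le_trans _ _ (exp (A%:R * rp d n))).
  by apply: le_trans (card_nexp_rp d0 n0); rewrite ler_nat.
apply: le_trans (Rexp_le (rp_scale n d0 (isT : (0 < A)%N))) _.
rewrite RexpD mulrC; apply: ler_pM; rewrite ?(ltW (Rexp_gt0 _)) //.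
  by apply: le_trans (Rexp_nat_le A) _; rewrite ler_nat /C addnAC leq_addl.
by apply: Rexp_le; apply: rp_leq; rewrite leq_mul2r /C -addnA leq_addr orbT.
Qed.

Lemma growth_ge : exists C, forall n, exp (rp d n) <= C%:R * (gamma (C * n))%:R.
Proof.
(* [box_weight] and [box_size] bound the weight of the chosen box by this constant times [n]. *)
exists (d * 4 ^ d.+1)%N => n; set C := (d * _)%N.
have C4 : (4 <= C)%N.
  by rewrite /C expnSr mulnA leq_pmull // muln_gt0 d0 expn_gt0.
have [->|n0] := posnP n.
  rewrite muln0 rp0; apply: (le_trans Rexp1_le4); rewrite -natrM ler_nat.
  by apply: leq_trans C4 _; rewrite leq_pmulr // gamma0.
have [L /andP[L1 L2]] := box_size d n0.
apply: (@le_trans _ _ (2 ^ (L ^ d))%:R).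
  apply: pow2_ge_exp; have [l [l1 lX ->]] := @rp_root d n n0.
  have l0 : 0 <= l by lra.
  have lL : 2 * l <= L%:R.
    rewrite -(@ler_pXn2r _ d.+1) ?nnegrE ?mulr_ge0 // exprMn lX -!natrX -natrM.
    by rewrite ler_nat.
  apply: (@le_trans _ _ ((2 * l) ^+ d)).
    rewrite exprMn ler_wpM2r ?exprn_ge0 // -{1}[2]expr1 ler_weXn2l //; lra.
  by rewrite natrX; apply: lerXn2r; rewrite ?nnegrE ?mulr_ge0.
rewrite -natrM ler_nat; apply: (@leq_trans (gamma (C * n))).
  apply: gamma_ge; apply: leq_trans (box_weight _ d0) _.
  by rewrite /C -mulnA leq_mul2l L2 orbT.
by rewrite leq_pmull // (leq_trans _ C4).
Qed.

Lemma growth_simR : simR (fun n => INR (gamma n))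
  (fun n => exp (Rpower (INR n) (Rdiv (INR d) (INR d.+1)))).
Proof.
have [C hC] := growth_le; have [C' hC'] := growth_ge; split.
  by exists C => n; apply/RleP; have := hC n; rewrite -!INRE.
by exists C' => n; apply/RleP; have := hC' n; rewrite -!INRE.
Qed.

Lemma growth_superpoly e : precsim (fun n => n ^ e)%N gamma.
Proof.
(* [K] is the constant of [pow_le_exp] for [n ^ e <= rp d n ^+ (2 e)]. *)
have [C hC] := growth_ge; pose K := ((e * 2) ^ (e * 2))%N.
have K0 : (0 < K)%N by rewrite /K; case: (e) => // e'; rewrite expn_gt0.
exists (K * C)%N => n; rewrite -(ler_nat R) natrM.
apply: (@le_trans _ _ (K%:R * exp (rp d (K * n)))); last first.
  rewrite natrM -mulrA ler_wpM2l // (le_trans (hC _)) // mulnA [(C * K)%N]mulnC.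
  exact: lexx.
apply: (@le_trans _ _ (rp d n ^+ (e * 2))).
  by rewrite natrX mulnC exprM; apply: lerXn2r; rewrite ?nnegrE ?exprn_ge0 ?rp_sqr //
    (le_trans _ (rp_ge1 _ _)).
apply: le_trans (pow_le_exp _ (le_trans ler01 (rp_ge1 _ _))) _.
by rewrite ler_wpM2l // Rexp_le // rp_leq // leq_pmull.
Qed.

Lemma growth_intermediate : intermediate gamma.
Proof.
have [C hC] := growth_le; split; last first.
  move=> e; split; first exact: growth_superpoly.
  case=> C2 h2; have [C1 h1] := growth_superpoly e.+1.
  (* Composing both bounds gives [n ^ e.+1 <= D ^ e.+1 * n ^ e], false at [n = D ^ e.+1 + 1]. *)
  pose D := (C1 * C2)%N.
  have {h1}h n : (n ^ e.+1 <= D ^ e.+1 * n ^ e)%N.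
    apply: leq_trans (h1 n) _; apply: leq_trans (leq_mul (leqnn C1) (h2 _)) _.
    by rewrite mulnA [(C2 * _)%N]mulnA [(C2 * C1)%N]mulnC -/D expnMn mulnA expnS.
  have := h (D ^ e.+1).+1.
  by rewrite expnS leq_mul2r expn_eq0 /= ltnn.
split.
  exists (4 * C)%N => n; rewrite -(ler_nat R).
  apply: (le_trans (hC n)).
  apply: (@le_trans _ _ (C%:R * exp (1 + C * n)%N%:R)).
    by rewrite ler_wpM2l // Rexp_le // natrD rp_le1D.
  apply: (@le_trans _ _ (C * 4 ^ (1 + C * n))%:R).
    by rewrite natrM ler_wpM2l // Rexp_nat_le.
  rewrite ler_nat expnD expn1 mulnA [(C * 4)%N]mulnC leq_mul2l.
  have -> : (4 ^ (C * n) = 2 ^ (2 * (C * n)))%N by rewrite (expnM 2 2).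
  by rewrite leq_pexp2l ?orbT // -[X in (_ <= X)%N]mulnA leq_mul2r orbT.
case=> C0 h0.
have C0C : (0 < C0 * C)%N.
  rewrite lt0n muln_eq0; apply/negP => /orP[] /eqP z.
    by move: (h0 0%N); rewrite z.
  have : (gamma (C0 * 0))%:R <= 0 :> R.
    by apply: le_trans (hC _) _; rewrite z mul0r.
  by rewrite muln0 lern0 => /eqP g0; have := gamma0; rewrite g0.
(* At argument [N ^ d.+1] the assumed bound yields [N ^ d.+1 <= D + 2 * (D * N) ^ d], and [N] is
   chosen just large enough to contradict this. *)
pose D := (C0 * C)%N; pose N := (D + 2 * D ^ d).+1.
have : (2 ^ (N ^ d.+1) <= 2 ^ (D + 2 * (D * N) ^ d))%N.
  apply: leq_trans (h0 _) _; rewrite -(ler_nat R) natrM.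
  apply: le_trans (ler_wpM2l (ler0n _ _) (hC _)) _; rewrite mulrA -natrM -/D.
  rewrite mulnA [(C * C0)%N]mulnC -/D expnD natrM; apply: ler_pM => //.
  - exact/ltW/Rexp_gt0.
  - by rewrite ler_nat ltnW // ltn_expl.
  - apply: le_trans (Rexp_le (rp_mulX d C0C (ltn0Sn _))) _.
    by rewrite -natrX expnM; apply: Rexp_nat_le.
rewrite leq_exp2l // expnMn expnS => h.
have Nd : (0 < N ^ d)%N by rewrite expn_gt0.
have : (N * N ^ d <= (D + 2 * D ^ d) * N ^ d)%N.
  apply: leq_trans h _; rewrite mulnDl mulnA leq_add2r.
  by rewrite leq_pmulr.
by rewrite leq_mul2r eqn0Ngt Nd /= ltnn.
Qed.

End GrowthType.

(** * The growth function of the presented algebra *)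

Section Growth.
Variables (k : fieldType) (d : nat).
Local Notation Q := (presAlg (alg_rels k d)).

Definition alg_e : Q := cl _ (ncgen k None).
Definition alg_g (x : 'I_d * bool) : Q := cl _ (ncgen k (Some x)).

Lemma cl_br p q : cl (alg_rels k d) (ncbr p q) = cl _ p * cl _ q - cl _ q * cl _ p.
Proof. by rewrite cl_cat cl_opp !cl_mul. Qed.

Lemma cl_iad w : cl _ (nciad k w) = iad alg_e alg_g w.
Proof. by elim: w => // r w IH; rewrite /= cl_br IH. Qed.

Lemma alg_gC x y : alg_g x * alg_g y = alg_g y * alg_g x.
Proof.
apply/eqP; rewrite -subr_eq0 -cl_br; apply/eqP/cl_eq0/in_ideal_rel.
by rewrite mem_cat; apply/orP; left; apply/allpairsP; exists (x, y); rewrite !mem_enum.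
Qed.

Lemma alg_se r : alg_g (r, true) * alg_e =
  alg_e * alg_g (r, true) + iad alg_e alg_g [:: r] * alg_g (r, false).
Proof.
apply/eqP; rewrite addrC -subr_eq -subr_eq0 -cl_br -cl_iad -cl_mul -cl_opp -cl_cat.
apply/eqP/cl_eq0/in_ideal_rel.
by rewrite !mem_cat; apply/or3P/Or32/mapP; exists r; rewrite // mem_enum.
Qed.

Lemma alg_iadC v w : iad alg_e alg_g v * iad alg_e alg_g w =
  iad alg_e alg_g w * iad alg_e alg_g v.
Proof.
apply: iad_comm => [||U V]; [exact: alg_gC | exact: alg_se |].
apply/eqP; rewrite -!cl_iad -subr_eq0 -cl_br; apply/eqP/cl_eq0/in_ideal_rel.
rewrite !mem_cat; apply/or3P/Or33/allpairsP.
by exists (U, V); rewrite !mem_enum.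
Qed.

Lemma nspan_in_Xn n p : in_Xn n p ->
  nspan alg_e alg_g (@qcst _ _ _) (n * 2) (cl (alg_rels k d) p).
Proof.
move=> /allP pn; rewrite clE big_seq; elim/big_rec: _ => [|t x tp IH].
  exact: nspan0.
apply: nspan_add IH; apply: nspan_cst; first exact: qcstM.
apply: (@nspan_le _ _ _ _ _ _ (size t.2 * 2)); first by rewrite leq_mul2r pn.
have := nspan_word alg_gC alg_se (@qcstC _ _ _) (@qcst1 _ _ _) (@qcstM _ _ _)
  [seq enum_val i | i <- t.2].
rewrite size_map big_map; congr nspan; apply: eq_bigr => i _.
by rewrite -{2}[i]enum_valK; case: (enum_val i).
Qed.

Lemma indep_le n c : indep_in_Xn (alg_rels k d) n c ->
  (c <= #|{: nexp d (n * 2) (n * 2)}|)%N.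
Proof.
case=> ps [psn ind].
(* Both parameters of [nexp] are [2 n]: the first bounds the weight of words of length [n], the
   second satisfies [2 n < 2 ^ (2 n)]. *)
have /fin_all_exists[a aE] (j : 'I_c) : exists a : nexp d (n * 2) (n * 2) -> k,
    cl (alg_rels k d) (ps j) = \sum_f qcst _ (a f) * nbasis alg_e alg_g f.
  apply: nspan_nbasis (nspan_in_Xn (psn j)); [exact: alg_gC | exact: alg_iadC
    | exact: qcstD | exact: ltn_expl].
apply: (indep_leq_card (@qcstD _ _ (alg_rels k d)) (@qcstM _ _ _) aE) => lam e.
apply: ind; apply/cl_eq0; rewrite cl_flatten big_map big_enum -[RHS]e /=.
by apply: eq_bigr => j _; rewrite cl_scale.
Qed.

(** Sizes of independent families are bounded by [indep_le], and the empty family is one, so a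
    largest size exists. *)
Lemma growth_value_exists n : exists c, growth_value (alg_rels k d) n c.
Proof.
pose P c := `[< indep_in_Xn (alg_rels k d) n c >].
have exP : exists c, P c.
  by exists 0%N; apply/asboolP; exists (fun=> [::]); split=> [|? _] [].
have bP c : P c -> (c <= #|{: nexp d (n * 2) (n * 2)}|)%N by move/asboolP/indep_le.
have [c /asboolP Pc cmax] := ex_maxnP exP bP; exists c; split=> // c' ?.
exact/cmax/asboolP.
Qed.

End Growth.

Local Close Scope ring_scope.

Theorem theorem1 (k : fieldType) (d : nat) : 0 < d ->
  exists (m : nat) (rels : seq (ncpoly k m)) (gamma : nat -> nat),
    (forall n, growth_value rels n (gamma n)) /\
    simR (fun n => INR (gamma n))
         (fun n => exp (Rpower (INR n) (Rdiv (INR d) (INR d.+1)))) /\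
    intermediate gamma.
Proof.
move=> d0; have [gamma gammaP] := choice (growth_value_exists k d).
have gamma_le n : gamma n <= #|{: nexp d (n * 2) (n * 2)}|.
  exact/indep_le/(gammaP n).1.
have gamma_ge n L : \sum_(al : {ffun 'I_d -> 'I_L}) (\sum_r al r).+1 <= n ->
    2 ^ (L ^ d) <= gamma n.
  move=> /(subset_indep k)/(gammaP n).2.
  (* The box has [L ^ d] points, hence [2 ^ (L ^ d)] subsets. *)
  by rewrite -cardsT -powersetT card_powerset cardsT card_ffun !card_ord.
exists (ngens d), (alg_rels k d), gamma; split=> //; split.
  exact: growth_simR.
exact: growth_intermediate d0 gamma_le gamma_ge.
Qed.
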